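(* Let $K$ be an algebraically closed field of characteristic $p>0$ and let $f(x)\in K[x]$ be a monic polynomial that has at least two distinct roots. Write $\gcd(f)=p^s\gcd_p(f)$ with $p\nmid\gcd_p(f)$, and $f(x)=f_1^{p^s}(x)$ for the unique monic nonscalar polynomial $f_1(x)\in K[x]$. Then the following statements are equivalent: 1. $\widetilde G_f=\{e\}$ and $\overline G_f=\langle\sigma_{\lambda_n,(1-\lambda_n)\nu}\rangle\ne\{e\}$ where $\lambda_n$ is a primitive $n$'th root of unity and $\nu\in K$. 2. $f(x)=(x-\nu)^ig((x-\nu)^n)$ for some natural number $i\ge0$ and a monic nonscalar polynomial $g(x)\in K[x]$ such that $g(0)\ne0$, and (a) $n\ge2$, $p\nmid n$ and $\gcd_p(g(x))=1$, and (b) $\mathcal R(f)+\mathbb F_p(\lambda-\lambda')\not\subseteq\mathcal R(f)$ for all distinct roots $\lambda$ and $\lambda'$ of $f$. Suppose that statement 1 holds. Then the presentation $f(x)=(x-\nu)^ig((x-\nu)^n)$ is unique, i.e. the triple $(\nu,i,g(x))$ is unique. Either $\nu$ is a root of $f(x)$ (i.e. $i\ge1$) or otherwise (i.e. $i=0$) $\nu$ is a root of the derivative $f_1'(x)$. If $\nu$ is a root of $f(x)$ then $n=\gcd_p(x^{-i}f(x+\nu))$. If $\nu$ is not a root of $f(x)$ then $n=\gcd_p(f(x+\nu))$. Furthermore, $\sigma_{\lambda_n,(1-\lambda_n)\nu}(f)=\lambda_n^if$, and $f\in K[x]^{G_f}$ if and only if $n\mid i$.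
   Context: $\mathrm{Aut}_K(K[x])=\{\sigma_{\lambda,\mu}\mid\lambda\in K^\times,\mu\in K\}$, $\sigma_{\lambda,\mu}(x)=\lambda x+\mu$. The eigengroup of $f$ is $G_f=\{\sigma\in\mathrm{Aut}_K(K[x])\mid\sigma(f)\in K^\times f\}$. Let $\mathrm{Sh}(K)=\{\sigma_{1,\mu}\mid\mu\in K\}$. When $f$ has at least two distinct roots, $G_f$ is finite and $G_f=\widetilde G_f\rtimes\overline G_f$, where $\widetilde G_f=G_f\cap\mathrm{Sh}(K)$ and $\overline G_f$ is a (cyclic) complement of the form $\langle\sigma_{\lambda_n,(1-\lambda_n)\nu}\rangle$ with $\lambda_n\in K$ a primitive $n$'th root of unity and $\nu\in K$. For a monic polynomial $f=\sum a_ix^i$ of degree $\ge1$, $\gcd(f):=\gcd\{i\ge1\mid a_i\ne0\}$, and $\gcd(f)=p^s\gcd_p(f)$ with $s\ge0$, $p\nmid\gcd_p(f)$. $\mathcal R(f)$ is the multiset of roots of $f$ counted with multiplicity; $\mathcal R(f)+W\subseteq\mathcal R(f)$ means that translation by each element of $W$ maps this multiset into itself. $\mathbb F_p(\lambda-\lambda')$ is the set of $\mathbb F_p$-multiples of the element $\lambda-\lambda'$. $K[x]^{G_f}$ is the algebra of $G_f$-invariants. In the equivalence, $n$ and $\nu$ are the same in statements 1 and 2. *)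

(* Defs.v *)
From mathcomp Require Import all_boot all_order all_algebra.

Set Implicit Arguments.
Unset Strict Implicit.
Unset Printing Implicit Defensive.

Import GRing.Theory.
Local Open Scope ring_scope.

(* Subgroups of Aut_K(K[x]) are predicates on functions K[x] -> K[x]; two
   automorphisms are identified when they are pointwise equal (=1). *)
Section Eigengroup.

Variable K : fieldType.

Implicit Types (f g h : {poly K}) (s t u : {poly K} -> {poly K}).
Implicit Types G N H : ({poly K} -> {poly K}) -> Prop.

Definition is_aut s : Prop :=
  [/\ bijective s, linear s & GRing.monoid_morphism s].

Definition sigma (lam mu : K) : {poly K} -> {poly K} :=
  fun h => h \Po (lam *: 'X + mu%:P).

Definition eigengroup f s : Prop :=
  is_aut s /\ exists2 c : K, c != 0 & s f = c *: f.

Definition shift s : Prop := exists mu : K, s =1 sigma 1 mu.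

Definition eigengroup_shift f s : Prop := eigengroup f s /\ shift s.

(* On the bijections considered here, [cancel s t] says that t is the inverse
   of s. *)
Definition subgroup H G : Prop :=
  [/\ forall s, H s -> G s,
      H id,
      forall s t, H s -> H t -> H (s \o t)
    & forall s t, H s -> cancel s t -> H t].

Definition normal_subgroup N G : Prop :=
  subgroup N G /\
  forall s t u, G s -> cancel s t -> N u -> N (s \o u \o t).

Definition semidirect G N H : Prop :=
  [/\ normal_subgroup N G,
      subgroup H G,
      forall s, N s -> H s -> s =1 id
    & forall s, G s -> exists t u, [/\ N t, H u & s =1 t \o u]].

Definition cyclic_subgroup s t : Prop :=
  exists k : nat, t =1 iter k s \/ cancel t (iter k s).

Definition trivial_group H : Prop := forall s, H s <-> s =1 id.

Definition group_invariant G h : Prop := forall s, G s -> s h = h.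

(* gcd {i >= 1 | f`_i != 0}, meaningful for f of degree at least 1 *)
Definition poly_gcd f : nat :=
  \big[gcdn/0%N]_(1 <= i < size f | f`_i != 0) i.

(* poly_gcd f = p ^ poly_gcd_exp p f * poly_gcd_p p f, with p not dividing
   the second factor *)
Definition poly_gcd_exp (p : nat) f : nat := logn p (poly_gcd f).
Definition poly_gcd_p (p : nat) f : nat := ((poly_gcd f)`_p^')%N.

Definition is_frobenius_root (p : nat) f f1 : Prop :=
  [/\ f1 \is monic, (1 < size f1)%N & f = f1 ^+ (p ^ poly_gcd_exp p f)%N].

(* The multiset of roots of f, as a multiplicity function. *)
Definition roots_mset f : K -> nat := fun a => mup a f.

(* R(f) + W is contained in R(f): the multiset R(f) + w has multiplicity
   roots_mset f (a - w) at a. *)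
Definition roots_translate_sub f (W : K -> Prop) : Prop :=
  forall w, W w -> forall a, (roots_mset f (a - w) <= roots_mset f a)%N.

(* Only used when p is the characteristic of K, where c |-> c%:R is the
   embedding of 'F_p in K. *)
Definition Fp_line (p : nat) (a : K) : K -> Prop :=
  fun w => exists c : 'F_p, w = (c : nat)%:R * a.

Definition presentation f (n : nat) (nu : K) (i : nat) g : Prop :=
  [/\ f = ('X - nu%:P) ^+ i * (g \Po (('X - nu%:P) ^+ n)),
      g \is monic, (1 < size g)%N & g.[0] != 0].

(* The chosen complement of eigengroup_shift f in eigengroup f is the cyclic
   group generated by sigma lam ((1 - lam) * nu). *)
Definition cyclic_eigengroup f (n : nat) (nu lam : K) : Prop :=
  let C := cyclic_subgroup (sigma lam ((1 - lam) * nu)) in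
  [/\ n.-primitive_root lam,
      trivial_group (eigengroup_shift f),
      semidirect (eigengroup f) (eigengroup_shift f) C
    & ~ trivial_group C].

Definition cyclic_presentation (p : nat) f (n : nat) (nu : K) : Prop :=
  exists i g,
    [/\ presentation f n nu i g,
        [/\ (2 <= n)%N, ~~ (p %| n)%N & poly_gcd_p p g = 1%N]
      & forall a b : K, root f a -> root f b -> a != b ->
          ~ roots_translate_sub f (Fp_line p (a - b))].

End Eigengroup.

(* Main.v *)
Require Import Defs.
From mathcomp Require Import all_boot all_order all_algebra.
From mathcomp Require Import cyclic separable cyclotomic ring.

Set Implicit Arguments.
Unset Strict Implicit.
Unset Printing Implicit Defensive.

Import GRing.Theory.
Local Open Scope ring_scope.

(* Write D_a for the dilation x - nu |-> a (x - nu). If D_lam is in the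
   eigengroup with lam <> 1, and the eigengroup contains no nontrivial shift,
   then every element sigma of it commutes with D_lam, since the commutator is
   a shift; hence sigma fixes nu and is itself a dilation. Comparing
   coefficients in f(x + nu), D_a is an eigen-automorphism of
   f = (x - nu)^i g((x - nu)^n), g(0) <> 0, exactly when a^(n j) = 1 for all j
   in the support of g, i.e. when a^(n gcd(g)) = 1. By injectivity of the
   Frobenius this reads a^(n gcd_p(g)) = 1, so that the group of these a has
   order n exactly when gcd_p(g) = 1. Over a closed field, a shift fixes the
   monic f exactly when it preserves the multiset of roots, which is (b). *)

(** * Elementary facts on roots of unity *)

Lemma unity_root_neq0 (R : nzRingType) (a : R) n :
  (0 < n)%N -> a ^+ n = 1 -> a != 0.
Proof.
move=> n_gt0 an; apply: contraTneq (oner_neq0 R) => a0.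
by rewrite -an a0 expr0n -leqn0 leqNgt n_gt0 eqxx.
Qed.

Lemma prim_root_neq1 (R : nzRingType) n (lam : R) :
  n.-primitive_root lam -> (1 < n)%N -> lam != 1.
Proof.
move=> lam_n n_gt1.
by rewrite -[lam]expr1 -(prim_order_dvd lam_n) dvdn1 gtn_eqF.
Qed.

(** * Powers of the Frobenius map *)

Section Frobenius.

Variables (p : nat) (pr_p : prime p).

Lemma pchar_pnat_expn (R : nzRingType) s : p \in [pchar R] ->
  [pchar R].-nat (p ^ s)%N.
Proof.
by move=> pR; rewrite pnatX; apply/orP; left; apply/pnatP=> [|q pr_q];
  rewrite ?prime_gt0 // dvdn_prime2 // => /eqP ->.
Qed.

(** In characteristic [p], with q = p^s, one has x^q - y^q = (x - y)^q, and in a domain this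
    vanishes only when x = y. *)
Lemma expr_pexpn_inj (R : idomainType) s : p \in [pchar R] ->
  injective (fun x : R => x ^+ (p ^ s)%N).
Proof.
move=> pR x y /= /eqP; have pnat_q := pchar_pnat_expn s pR.
rewrite -subr_eq0 -(exprNn_pchar _ pnat_q) -(exprDn_pchar _ _ pnat_q).
by rewrite expf_eq0 => /andP[_]; rewrite subr_eq0 => /eqP.
Qed.

Lemma expr_sum_pexpn (R : comNzRingType) s (I : Type) (r : seq I) (P : pred I)
    (F : I -> R) : p \in [pchar R] ->
  (\sum_(i <- r | P i) F i) ^+ (p ^ s)%N =
    \sum_(i <- r | P i) F i ^+ (p ^ s)%N.
Proof.
move=> pR; apply: (big_morph (fun x : R => x ^+ (p ^ s)%N)).
  by move=> x y; apply/exprDn_pchar/pchar_pnat_expn.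
by rewrite expr0n expn_eq0 -leqn0 leqNgt prime_gt0.
Qed.

End Frobenius.

(** * The gcd of the exponents of a polynomial, and scaling of the variable *)

Section PolyGcd.

Variable K : fieldType.
Implicit Types f g h : {poly K}.

(** The bounds on the index disappear: every number divides 0, and coefficients beyond the degree
    vanish. *)
Lemma dvdn_poly_gcdP f d :
  reflect (forall j, f`_j != 0 -> (d %| j)%N) (d %| poly_gcd f)%N.
Proof.
rewrite /poly_gcd big_add1 big_mkord; apply: (iffP (dvdn_biggcdP _ _ _)).
  move=> df [|j] fj; first exact: dvdn0.
  have ltj : (j < (size f).-1)%N.
    by rewrite -ltnS (ltn_predK (m := 0)) ltnNge; apply: contra fj => /leq_sizeP->.
  exact: (df (Ordinal ltj)).
by move=> df j; apply: df.
Qed.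

Lemma poly_gcd_dvd f j : f`_j != 0 -> (poly_gcd f %| j)%N.
Proof. by move: j; apply/dvdn_poly_gcdP. Qed.

Lemma poly_gcd_gt0 f : (1 < size f)%N -> (0 < poly_gcd f)%N.
Proof.
move=> f_gt1; apply: (@dvdn_gt0 _ (size f).-1); first by rewrite -ltnS prednK // ltnW.
by apply: poly_gcd_dvd; rewrite -lead_coefE lead_coef_eq0 -size_poly_gt0 ltnW.
Qed.

(** The support of g(X^n) is [n] times the support of [g]. *)
Lemma poly_gcd_comp_polyXn g n : (0 < n)%N ->
  poly_gcd (g \Po 'X^n) = (n * poly_gcd g)%N.
Proof.
move=> n_gt0; apply/eqP; rewrite eqn_dvd; apply/andP; split; last first.
  apply/dvdn_poly_gcdP=> j; rewrite coef_comp_poly_Xn //.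
  case: ifP => [/dvdnP[k ->]|_]; last by rewrite eqxx.
  by rewrite mulnK // mulnC dvdn_pmul2r // => /poly_gcd_dvd.
have /dvdnP[k Dk] : (n %| poly_gcd (g \Po 'X^n))%N.
  by apply/dvdn_poly_gcdP=> j; rewrite coef_comp_poly_Xn //; case: ifP; rewrite ?eqxx.
rewrite Dk mulnC dvdn_pmul2l //; apply/dvdn_poly_gcdP=> j gj.
rewrite -(dvdn_pmul2r n_gt0) -Dk; apply: poly_gcd_dvd.
by rewrite coef_comp_poly_Xn // dvdn_mull // mulnK.
Qed.

Lemma poly_gcd_p_comp_polyXn p g n : prime p -> ~~ (p %| n)%N -> (0 < n)%N ->
  (1 < size g)%N -> poly_gcd_p p g = 1%N -> poly_gcd_p p (g \Po 'X^n) = n.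
Proof.
move=> pr_p pn n_gt0 g_gt1 g1; rewrite /poly_gcd_p poly_gcd_comp_polyXn //.
rewrite partnM ?poly_gcd_gt0 // -/(poly_gcd_p p g) g1 muln1.
by rewrite part_pnat_id // p'natE.
Qed.

Lemma poly_gcdE p f : (1 < size f)%N ->
  poly_gcd f = (p ^ poly_gcd_exp p f * poly_gcd_p p f)%N.
Proof.
by move=> f_gt1; rewrite /poly_gcd_exp -p_part partnC // poly_gcd_gt0.
Qed.

Lemma coef_comp_scaleX h (a : K) k : (h \Po (a *: 'X))`_k = a ^+ k * h`_k.
Proof.
have -> : h \Po (a *: 'X) = \poly_(i < size h) (a ^+ i * h`_i).
  rewrite comp_polyE poly_def; apply: eq_bigr => i _.
  by rewrite exprZn scalerA mulrC.
rewrite coef_poly; case: ltnP => // /leq_sizeP -> //.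
by rewrite mulr0.
Qed.

(** The coefficient at [i] is g(0), nonzero, and determines [c]; the coefficient at i + nj then
    gives the condition on [a] after cancelling a^i. *)
Lemma comp_scaleX_XnM g (a : K) i n : (0 < n)%N -> g`_0 != 0 -> a != 0 ->
  forall c, ('X^i * (g \Po 'X^n)) \Po (a *: 'X) = c *: ('X^i * (g \Po 'X^n)) <->
    c = a ^+ i /\ forall j, g`_j != 0 -> a ^+ (n * j) = 1.
Proof.
move=> n_gt0 g0 a0 c; set h := _ * _.
have hE j : h`_(i + n * j) = g`_j.
  rewrite coefXnM ltnNge leq_addr addKn coef_comp_poly_Xn //.
  by rewrite dvdn_mulr // mulKn.
split=> [/polyP e | [-> aj]].
  have Dc : c = a ^+ i.
    have := e (i + n * 0)%N; rewrite coef_comp_scaleX coefZ hE muln0 addn0.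
    by move/(mulIf g0).
  split=> // j gj; have := e (i + n * j)%N.
  rewrite coef_comp_scaleX coefZ hE Dc => /(mulIf gj).
  by rewrite exprD -[RHS]mulr1 => /mulfI -> //; rewrite expf_neq0.
apply/polyP=> k; rewrite coef_comp_scaleX coefZ coefXnM.
case: ltnP => [|le_ik]; first by rewrite !mulr0.
rewrite coef_comp_poly_Xn //; case: ifP => [/dvdnP[j Dj]|_]; last by rewrite !mulr0.
rewrite Dj mulnK // -(subnKC le_ik) Dj exprD mulnC.
by have [->|/aj ->] := eqVneq g`_j 0; rewrite ?mulr0 ?mulr1.
Qed.

(** All exponents k in the support of [h] satisfy lam^k = c, so they are congruent modulo [n]; [i]
    is the least of them. *)
Lemma comp_scaleX_eigenP h (lam c : K) n : h \is monic ->
  n.-primitive_root lam -> h \Po (lam *: 'X) = c *: h ->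
  exists i g, [/\ h = 'X^i * (g \Po 'X^n), g \is monic & g`_0 != 0].
Proof.
move=> h_monic lam_n /polyP e; have n_gt0 := prim_order_gt0 lam_n.
have lamE k : h`_k != 0 -> lam ^+ k = c.
  by move=> hk; have := e k; rewrite coef_comp_scaleX coefZ => /(mulIf hk).
have ex_i : exists i, h`_i != 0.
  by exists (size h).-1; rewrite -lead_coefE lead_coef_eq0 monic_neq0.
case: (ex_minnP ex_i) => i hi min_i.
(* The bound [size h] is generous: as n >= 1, [h] has no coefficient at i + nj once j reaches it. *)
exists i, (\poly_(j < size h) h`_(i + n * j)); set g := \poly_(_ < _) _.
have gE j : g`_j = h`_(i + n * j).
  rewrite coef_poly; case: ltnP => // le_j.
  suff /leq_sizeP -> : (size h <= i + n * j)%N by [].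
  by rewrite (leq_trans le_j) // (leq_trans (leq_pmull _ n_gt0)) ?leq_addl.
have Dh : h = 'X^i * (g \Po 'X^n).
  apply/polyP=> k; rewrite coefXnM; case: ltnP => [lt_ki|le_ik].
    by apply/eqP; apply: contraLR lt_ki => /min_i; rewrite -leqNgt.
  rewrite coef_comp_poly_Xn //; case: ifP => [nk|/negbT nk].
    by rewrite gE mulnC divnK // subnKC.
  apply/eqP; apply: contraNT nk => hk.
  by rewrite -eqn_mod_dvd // -(eq_prim_root_expr lam_n) (lamE _ hk) (lamE _ hi).
split=> //; last by rewrite gE muln0 addn0.
have := h_monic; rewrite {1}Dh monicMl ?monicXn // !monicE lead_coef_comp.
  by rewrite lead_coefXn expr1n mulr1.
by rewrite size_polyXn.
Qed.

End PolyGcd.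

(** * Affine substitutions, dilations about a point, and their commutators *)

Section AffineSubstitutions.

Variable K : fieldType.
Implicit Types (f g h : {poly K}) (s t : {poly K} -> {poly K}).
Implicit Types a b c m nu lam : K.

Lemma sigma_comp a m b v h :
  sigma a m (sigma b v h) = sigma (b * a) (b * m + v) h.
Proof.
rewrite /sigma -comp_polyA comp_polyD comp_polyZ comp_polyX comp_polyC.
by rewrite scalerDr scalerA -addrA polyCD polyCM mul_polyC.
Qed.

Lemma sigma_id h : sigma 1 0 h = h.
Proof. by rewrite /sigma scale1r addr0 comp_polyXr. Qed.

Lemma sigma1E m h : sigma 1 m h = h \Po ('X + m%:P).
Proof. by rewrite /sigma scale1r. Qed.

Lemma sigmaK a m : a != 0 -> cancel (sigma a m) (sigma a^-1 (- m / a)).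
Proof.
move=> a0 h; rewrite sigma_comp mulfV // mulrCA mulfV // mulr1 addNr.
exact: sigma_id.
Qed.

Lemma sigmaVK a m : a != 0 -> cancel (sigma a^-1 (- m / a)) (sigma a m).
Proof.
move=> a0 h; rewrite sigma_comp mulVf // mulNr mulrC subrr.
exact: sigma_id.
Qed.

Lemma is_aut_sigma a m : a != 0 -> is_aut (sigma a m).
Proof.
move=> a0; split.
- by exists (sigma a^-1 (- m / a)); [apply: sigmaK | apply: sigmaVK].
- exact: comp_poly_is_linear.
- exact: comp_poly_is_monoid_morphism.
Qed.

Lemma is_aut_eq s t : s =1 t -> is_aut s -> is_aut t.
Proof.
move=> st [s_bij s_lin [s1 sM]]; split; first exact: eq_bij s_bij _ st.
  by move=> c u v; rewrite -!st s_lin.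
by split=> [|u v]; rewrite -!st.
Qed.

(** An algebra endomorphism is substitution of the image of ['X]. A preimage of ['X] composed with
    that image has degree 1, and degrees multiply under composition, so the image is affine. *)
Lemma is_autP s : is_aut s -> exists a m, a != 0 /\ s =1 sigma a m.
Proof.
case=> s_bij s_lin [s1 sM].
have s0 : s 0 = 0.
  by have := s_lin (-1) 0 0; rewrite scaler0 addr0 scaleN1r addNr.
have sC c : s c%:P = c%:P.
  by have := s_lin c 1 0; rewrite s0 !addr0 s1 alg_polyC.
have sD u v : s (u + v) = s u + s v by have := s_lin 1 u v; rewrite !scale1r.
have sE h : s h = h \Po s 'X.
  elim/poly_ind: h => [|h c IHh]; first by rewrite comp_poly0.
  by rewrite sD sM IHh sC comp_poly_MXaddC.
have size_sX : size (s 'X) = 2.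
  have [g _ gK] := s_bij; have /eqP := size_comp_poly (g 'X) (s 'X).
  rewrite -sE gK size_polyX eq_sym muln_eq1 => /andP[_ /eqP].
  by case: (size _) => //= k ->.
have sXE : s 'X = (s 'X)`_1 *: 'X + ((s 'X)`_0)%:P.
  apply/polyP=> k; rewrite coefD coefZ coefX coefC.
  case: k => [|[|k]] /=; rewrite ?mulr0 ?mulr1 ?addr0 ?add0r //.
  by apply/(leq_sizeP _ 2); rewrite ?size_sX.
exists (s 'X)`_1, (s 'X)`_0; split; last by move=> h; rewrite sE {1}sXE.
by have := lead_coef_eq0 (s 'X); rewrite lead_coefE size_sX
  -size_poly_eq0 size_sX => ->.
Qed.

Lemma eigengroup_eq f s t : s =1 t -> eigengroup f s -> eigengroup f t.
Proof.
by move=> st [s_aut [c c0 sf]]; split;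
  [apply: is_aut_eq s_aut | exists c; rewrite -?st].
Qed.

Lemma eigengroup_id f : eigengroup f id.
Proof.
split; last by exists 1; rewrite ?oner_neq0 ?scale1r.
by apply: is_aut_eq (is_aut_sigma 0 (oner_neq0 K)) => h; rewrite sigma_id.
Qed.

(** Injectivity of [sigma] excludes the eigenvalue 0, so any eigenvector equation suffices. *)
Lemma eigengroup_sigma f a m c :
  f != 0 -> a != 0 -> sigma a m f = c *: f -> eigengroup f (sigma a m).
Proof.
move=> f0 a0 sf; split; first exact: is_aut_sigma.
exists c => //; apply: contra f0 => /eqP c0.
by move: sf; rewrite c0 scale0r -(inj_eq (can_inj (sigmaK m a0))) => ->;
  rewrite /sigma comp_poly0.
Qed.

Definition dilation nu a := sigma a ((1 - a) * nu).

Lemma dilation_comp nu a b h :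
  dilation nu a (dilation nu b h) = dilation nu (a * b) h.
Proof. by rewrite /dilation sigma_comp mulrC; congr (sigma _ _ h); ring. Qed.

Lemma dilation1 nu h : dilation nu 1 h = h.
Proof. by rewrite /dilation subrr mul0r sigma_id. Qed.

Lemma iter_dilation nu a k h : iter k (dilation nu a) h = dilation nu (a ^+ k) h.
Proof.
elim: k => [|k IHk] /=; first by rewrite dilation1.
by rewrite IHk dilation_comp exprS.
Qed.

Lemma dilation_comp_XaddC nu a h :
  dilation nu a h \Po ('X + nu%:P) = (h \Po ('X + nu%:P)) \Po (a *: 'X).
Proof.
rewrite /dilation /sigma -!comp_polyA; congr (h \Po _).
rewrite !comp_polyD comp_polyZ !comp_polyX !comp_polyC.
rewrite scalerDr -!mul_polyC -addrA; congr (_ + _).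
by rewrite polyCM polyCB; ring.
Qed.

Lemma comp_XaddC_inj nu : injective (fun h => h \Po ('X + nu%:P)).
Proof. exact: (can_inj (fun h => comp_polyXaddC_K h nu)). Qed.

(** In the coordinate centred at [nu] the dilation is a plain scaling of the variable, so the
    eigenvector equation can be read coefficient by coefficient. *)
Lemma dilation_eigenE nu a c h : dilation nu a h = c *: h <->
  (h \Po ('X + nu%:P)) \Po (a *: 'X) = c *: (h \Po ('X + nu%:P)).
Proof.
rewrite -dilation_comp_XaddC -comp_polyZ; split=> [-> //|].
exact: comp_XaddC_inj.
Qed.

Lemma monic_comp_XaddC nu h : (h \Po ('X + nu%:P) \is monic) = (h \is monic).
Proof.
by rewrite !monicE lead_coef_comp ?size_XaddC // lead_coefXaddC expr1n mulr1.
Qed.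

(** The powers of [lam] exhaust the [n]-th roots of unity, a set closed under inversion, so the
    inverses of iterates add nothing new. *)
Lemma cyclic_subgroup_dilationP nu lam n t : n.-primitive_root lam ->
  cyclic_subgroup (dilation nu lam) t <->
    exists2 a, a ^+ n = 1 & t =1 dilation nu a.
Proof.
move=> lam_n; have lam0 : lam != 0.
  by rewrite (prim_root_eq0 lam_n) -lt0n (prim_order_gt0 lam_n).
split=> [[k [tE|tK]]|[a an tE]].
- exists (lam ^+ k); first by rewrite exprAC (prim_expr_order lam_n) expr1n.
  by move=> h; rewrite tE iter_dilation.
- exists (lam ^- k).
    by rewrite exprVn exprAC (prim_expr_order lam_n) expr1n invr1.
  move=> h; rewrite -{2}[h]tK iter_dilation dilation_comp mulVf ?dilation1 //.
  exact: expf_neq0.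
- have [k Dk] := prim_rootP lam_n an; exists k; left=> h.
  by rewrite tE iter_dilation Dk.
Qed.

Lemma eigengroup_fixpoint f a m nu lam :
  f != 0 -> (forall d, f \Po ('X + d%:P) = f -> d = 0) ->
  eigengroup f (sigma a m) -> a != 0 -> lam != 0 -> lam != 1 ->
  (exists c, dilation nu lam f = c *: f) -> m = (1 - a) * nu.
Proof.
move=> f0 noshift [_ [c c0 sf]] a0 lam0 lam1 [e df].
(* The two composites of [sigma a m] with the dilation have the same slope, and [d] is the
   difference of their constant terms. Both multiply [f] by the same scalar, so the shift by [d]
   fixes [f]; [d] factors as (1 - lam)(m - (1 - a) nu). *)
pose d := (1 - lam) * m - (1 - a) * (1 - lam) * nu.
have sigma_scalable b v : scalable (sigma b v) by move=> x h; rewrite /sigma comp_polyZ.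
have e1 : sigma a m (dilation nu lam f) = dilation nu lam (sigma a m f).
  rewrite df sf {1}/dilation !sigma_scalable -/(dilation nu lam f) df sf.
  by rewrite !scalerA mulrC.
have : d = 0.
  apply: noshift; rewrite -sigma1E.
  apply: (can_inj (sigmaK (lam * m + (1 - lam) * nu) (mulf_neq0 lam0 a0))).
  rewrite sigma_comp !mul1r.
  move: e1; rewrite /dilation !sigma_comp => ->.
  by rewrite mulrC; congr (sigma _ _ f); rewrite /d; ring.
move/eqP; rewrite /d mulrAC [_ * (1 - lam)]mulrC -mulrBr mulf_eq0 => /orP[].
  by rewrite subr_eq0 eq_sym (negPf lam1).
by rewrite subr_eq0 => /eqP.
Qed.

End AffineSubstitutions.

(** No eigenvalue appears: a shift preserves the leading coefficient, so on a monic [f] its only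
    possible eigenvalue is 1. *)
Definition shift_rigid (K : fieldType) (f : {poly K}) : Prop :=
  forall d : K, f \Po ('X + d%:P) = f -> d = 0.

(** * Eigengroups without shifts, and presentations of a polynomial *)

Section Eigengroups.

Variable K : fieldType.
Implicit Types (f g h : {poly K}) (s t : {poly K} -> {poly K}).
Implicit Types a b c m nu lam : K.

Lemma sigma1_eigen f d c : f \is monic -> sigma 1 d f = c *: f -> c = 1.
Proof.
move=> f_monic /(congr1 lead_coef).
rewrite lead_coefZ sigma1E (monicP f_monic) mulr1 => <-.
by apply/monicP; rewrite monic_comp_XaddC.
Qed.

Lemma trivial_eigengroup_shiftP f : f \is monic ->
  trivial_group (eigengroup_shift f) <-> shift_rigid f.
Proof.
move=> f_monic; have f0 := monic_neq0 f_monic; split=> [triv d fd | rigid s].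
  have /triv/(_ 'X) : eigengroup_shift f (sigma 1 d).
    split; last by exists d.
    by apply: (@eigengroup_sigma _ _ _ _ 1); rewrite ?oner_neq0 // sigma1E scale1r.
  rewrite sigma1E comp_polyX => /eqP.
  by rewrite -subr_eq0 addrAC subrr add0r polyC_eq0 => /eqP.
split=> [[[_ [c c0 sf]] [d sE]] h | s1].
  move: sf; rewrite sE => sf; have c1 := sigma1_eigen f_monic sf.
  move: sf; rewrite c1 scale1r sigma1E => /rigid d0.
  by rewrite sE d0 sigma_id.
have id_s : id =1 s by move=> h; rewrite s1.
split; first exact: eigengroup_eq id_s (eigengroup_id f).
by exists 0 => h; rewrite s1 sigma_id.
Qed.

Lemma eigengroup_dilation f nu lam c s :
  f \is monic -> shift_rigid f -> lam != 0 -> lam != 1 ->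
  dilation nu lam f = c *: f -> eigengroup f s ->
  exists2 a, a != 0 & s =1 dilation nu a.
Proof.
move=> f_monic rigid lam0 lam1 df s_eig.
have [a [m [a0 sE]]] := is_autP (proj1 s_eig); exists a => //.
have m_eq : m = (1 - a) * nu.
  apply: (@eigengroup_fixpoint _ f a m nu lam) => //; first exact: monic_neq0.
    exact: eigengroup_eq s_eig.
  by exists c.
by move=> h; rewrite sE m_eq.
Qed.

(** Once the shift part is trivial, the semidirect decomposition says that the eigengroup is the
    cyclic group itself, and nontriviality of that group amounts to n >= 2. The explicit list of
    dilations is the form used below. *)
Lemma cyclic_eigengroupP f n nu lam : f \is monic ->
  cyclic_eigengroup f n nu lam <->
  [/\ n.-primitive_root lam, shift_rigid f, (2 <= n)%N
    & forall s, eigengroup f s <-> exists2 a, a ^+ n = 1 & s =1 dilation nu a].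
Proof.
move=> f_monic.
rewrite /cyclic_eigengroup -/(dilation nu lam); set C := cyclic_subgroup _.
split.
  case=> lam_n triv [_ [C_sub C_id C_comp C_inv] _ gen] C_nontriv.
  have CP t := cyclic_subgroup_dilationP nu t lam_n.
  split=> //; first exact/trivial_eigengroup_shiftP.
    (* For n = 1 the only root of unity is 1, which would make [C] trivial. *)
    rewrite ltnNge; apply/negP => n_le1; apply: C_nontriv => t; split=> [|t1].
      case/CP=> a; have -> : n = 1%N.
        by apply/eqP; rewrite eqn_leq n_le1 (prim_order_gt0 lam_n).
      by rewrite expr1 => -> tE h; rewrite tE dilation1.
    by apply/CP; exists 1; rewrite ?expr1n // => h; rewrite t1 dilation1.
  move=> s; split=> [/gen[t [u [/triv t1 /CP[a an uE] sE]]]|].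
    by exists a => // h; rewrite sE /= t1 uE.
  by move/CP/C_sub.
case=> lam_n rigid n_gt1 eigP.
have CP t := cyclic_subgroup_dilationP nu t lam_n.
have /(trivial_eigengroup_shiftP f_monic) triv := rigid.
split=> //.
  split.
  - split; last first.
      (* A left inverse of a bijection is also a right inverse, so conjugating the identity gives
         the identity. *)
      move=> s t u [[[s' sK Ks] _ _] _] st /triv u1; apply/triv => h /=.
      by rewrite u1 -[in t h](Ks h) st Ks.
    split; first by move=> s [].
    + by apply/triv.
    + by move=> s t /triv s1 /triv t1; apply/triv=> h /=; rewrite s1 t1.
    + by move=> s t /triv s1 st; apply/triv=> h; rewrite -{1}[h]s1 st.
  - split.
    + by move=> s /CP/eigP.
    + by apply/CP; exists 1; rewrite ?expr1n // => h; rewrite dilation1.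
    + move=> s t /CP[a an sE] /CP[b bn tE]; apply/CP; exists (a * b).
        by rewrite exprMn an bn mulr1.
      by move=> h /=; rewrite tE sE dilation_comp.
    + move=> s t /CP[a an sE] st; apply/CP; exists a^-1.
        by rewrite exprVn an invr1.
      have a0 := unity_root_neq0 (ltnW n_gt1) an.
      move=> h; rewrite -{1}[h](dilation1 nu) -(mulfV a0) -dilation_comp -sE.
      exact: st.
  - by move=> s /triv.
  - move=> s /eigP/CP Cs; exists id, s; split=> //; exact/triv.
(* If [C] were trivial, its generator would fix ['X]; comparing linear coefficients would give lam =
   1. *)
move/(_ (dilation nu lam))=> [C_id _].
have /C_id/(_ 'X) : C (dilation nu lam) by exists 1%N; left.
rewrite /dilation /sigma comp_polyX => /polyP/(_ 1%N).
rewrite coefD coefZ coefX coefC /= mulr1 addr0 => /eqP.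
by rewrite (negPf (prim_root_neq1 lam_n n_gt1)).
Qed.

Lemma presentation_XaddC f n nu i g :
  presentation f n nu i g <->
  [/\ f \Po ('X + nu%:P) = 'X^i * (g \Po 'X^n), g \is monic, (1 < size g)%N
    & g`_0 != 0].
Proof.
have e : (('X - nu%:P) ^+ i * (g \Po (('X - nu%:P) ^+ n))) \Po ('X + nu%:P) =
    'X^i * (g \Po 'X^n).
  rewrite comp_polyM -comp_polyA !rmorphXn /=.
  by rewrite !comp_polyB !comp_polyX !comp_polyC addrK.
rewrite /presentation horner_coef0; split=> -[fE g_monic g_gt1 g0]; split=> //.
  by rewrite fE e.
by apply: (@comp_XaddC_inj _ nu); rewrite e.
Qed.

Lemma presentation_dilation f n nu i g a c :
  presentation f n nu i g -> (0 < n)%N -> a != 0 ->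
  dilation nu a f = c *: f <->
    c = a ^+ i /\ forall j, g`_j != 0 -> a ^+ (n * j) = 1.
Proof.
move=> /presentation_XaddC[fE _ _ g0] n_gt0 a0.
rewrite dilation_eigenE fE; exact: comp_scaleX_XnM.
Qed.

Lemma presentation_dilation_root f n nu i g a :
  presentation f n nu i g -> (0 < n)%N -> a ^+ n = 1 ->
  dilation nu a f = a ^+ i *: f.
Proof.
move=> f_pres n_gt0 an; have a0 := unity_root_neq0 n_gt0 an.
apply/(presentation_dilation _ f_pres) => //; split=> // j _.
by rewrite exprM an expr1n.
Qed.

Lemma presentation_root f n nu i g : presentation f n nu i g -> (0 < n)%N ->
  root f nu = (0 < i)%N.
Proof.
case=> -> _ _ g0 n_gt0; rewrite /root hornerM horner_exp hornerXsubC subrr.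
rewrite horner_comp horner_exp hornerXsubC subrr !expr0n.
rewrite [n == 0%N]eqn0Ngt n_gt0 mulf_eq0 (negPf g0) orbF.
by case: i => [|i]; rewrite ?oner_eq0 ?eqxx.
Qed.

(** Recentre at [nu] and cancel the lower power of ['X]: since g(0) is nonzero, no positive power
    can remain on the other side. Then composition with X^n is injective. *)
Lemma presentation_inj f n nu i g i' g' : (0 < n)%N ->
  presentation f n nu i g -> presentation f n nu i' g' -> i' = i /\ g' = g.
Proof.
move=> n_gt0.
wlog le_ii' : i g i' g' / (i <= i')%N => [wlog_le|].
  case/orP: (leq_total i i') => le_i f_pres f_pres'; first exact: wlog_le le_i _ _.
  by have [-> ->] := wlog_le _ _ _ _ le_i f_pres' f_pres.
move=> /presentation_XaddC[fE _ _ g0] /presentation_XaddC[fE' _ _ _].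
have e : g \Po 'X^n = 'X^(i' - i) * (g' \Po 'X^n).
  have Xi0 : 'X^i != 0 :> {poly K} by rewrite -size_poly_eq0 size_polyXn.
  by apply: (mulfI Xi0); rewrite mulrA -exprD subnKC // -fE.
have Di : i' = i.
  apply/eqP; rewrite eqn_leq le_ii' andbT -subn_eq0.
  move/polyP/(_ 0%N): e; rewrite coefXnM !coef_comp_poly_Xn // dvdn0 div0n.
  case: ltnP => [_ gE|]; first by rewrite gE eqxx in g0.
  by rewrite leqn0 => ->.
split=> //; move: e; rewrite Di subnn mul1r => /eqP; rewrite eq_sym -subr_eq0.
rewrite -comp_polyB comp_poly_eq0 ?size_polyXn // subr_eq0.
by move/eqP.
Qed.

(** The degree of [g] is a positive exponent killing [b], so [b] has a finite order; this order
    divides every exponent in the support, hence their gcd. *)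
Lemma expr_poly_gcd (g : {poly K}) b : (1 < size g)%N ->
  (forall j, g`_j != 0 -> b ^+ j = 1) -> b ^+ poly_gcd g = 1.
Proof.
move=> g_gt1 bj; pose m := (size g).-1.
have m_gt0 : (0 < m)%N by rewrite -ltnS prednK // ltnW.
have bm : b ^+ m = 1.
  by apply: bj; rewrite -lead_coefE lead_coef_eq0 -size_poly_gt0 ltnW.
have [k b_k _] := prim_order_exists m_gt0 bm.
apply/eqP; rewrite -(prim_order_dvd b_k); apply/dvdn_poly_gcdP => j /bj bj1.
by rewrite (prim_order_dvd b_k) bj1.
Qed.

Lemma comp_XaddC_mulrn f d k : f \Po ('X + d%:P) = f ->
  f \Po ('X + (k%:R * d)%:P) = f.
Proof.
move=> fd; elim: k => [|k IHk]; first by rewrite mul0r addr0 comp_polyXr.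
rewrite -{2}fd -{2}IHk -comp_polyA comp_polyD comp_polyX comp_polyC -addrA.
by rewrite -polyCD; congr (f \Po ('X + _%:P)); rewrite -natr1; ring.
Qed.

(** Invariance under [d] passes to each multiple w of [d]; substituting X - w then turns a power of
    X - (a - w) dividing [f] into the same power of X - a. *)
Lemma roots_translate_sub_shift f d p : f != 0 -> f \Po ('X + d%:P) = f ->
  roots_translate_sub f (Fp_line p d).
Proof.
move=> f0 fd _ [c ->] a; set w := _ * d.
have fw : f \Po ('X + w%:P) = f by apply: comp_XaddC_mulrn.
rewrite /roots_mset mup_geq // -{2}[f](comp_polyXaddC_K f w) fw.
have -> : 'X - a%:P = ('X - (a - w)%:P) \Po ('X - w%:P).
  by rewrite comp_polyB comp_polyX comp_polyC polyCB; ring.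
by rewrite -rmorphXn /= dvdp_comp_poly // -mup_geq.
Qed.

End Eigengroups.

(** * Algebraically closed fields: root multisets, roots of unity, Frobenius roots *)

Section ClosedField.

Variable K : closedFieldType.
Implicit Types (f g h : {poly K}).

(** Translation preserves the number of roots, so a translate contained in the finite root multiset
    is equal to it, and a split monic polynomial is determined by its roots. *)
Lemma shift_roots_translate_sub f (W : K -> Prop) b : f \is monic ->
  roots_translate_sub f W -> W b -> f \Po ('X + b%:P) = f.
Proof.
move=> f_monic f_tr Wb; have [r] := closed_field_poly_normal f.
rewrite (monicP f_monic) scale1r => fE.
have compE : f \Po ('X - b%:P) = \prod_(z <- map (+%R b) r) ('X - z%:P).
  rewrite fE rmorph_prod /= big_map; apply: eq_bigr => z _.
  by rewrite comp_polyB comp_polyX comp_polyC polyCD opprD addrA.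
have [s s_sub s_perm] : exists2 s, subseq s r & perm_eq (map (+%R b) r) s.
  apply/count_subseqP => a.
  have -> : count_mem a (map (+%R b) r) = count_mem (a - b) r.
    rewrite count_map; apply: eq_count => z /=.
    by rewrite [RHS]eq_sym subr_eq addrC eq_sym.
  by rewrite -!mu_prod_XsubC -fE; apply: f_tr.
have s_r : s = r.
  apply/eqP; rewrite -(size_subseq_leqif s_sub).
  by rewrite -(perm_size s_perm) size_map.
have fb : f \Po ('X - b%:P) = f by rewrite compE (perm_big _ s_perm) s_r -fE.
by rewrite -{1}fb -comp_polyA comp_polyB comp_polyX comp_polyC addrK comp_polyXr.
Qed.

(** The line through a - b contains a - b itself, which gives one direction. Conversely, a nonzero
    shift [d] fixing [f] moves a root [a0] to a second root a0 + d. *)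
Lemma shift_rigidP f p : prime p -> f \is monic -> (exists a, root f a) ->
  shift_rigid f <->
  forall a b : K, root f a -> root f b -> a != b ->
    ~ roots_translate_sub f (Fp_line p (a - b)).
Proof.
move=> pr_p f_monic [a0 fa0]; split=> [rigid a b _ _ /negP neq_ab f_tr | rigid d fd].
  apply: neq_ab; rewrite -subr_eq0; apply/eqP/rigid.
  apply: shift_roots_translate_sub f_tr _ => //.
  exists 1; rewrite /= modn_small ?mul1r //.
apply/eqP; apply/negPn/negP => d0; apply: (rigid (a0 + d) a0) => //.
- by move: fa0; rewrite -{1}fd root_comp hornerD hornerX hornerC.
- by rewrite -subr_eq0 addrAC subrr add0r.
rewrite addrAC subrr add0r; apply: roots_translate_sub_shift => //.
exact: monic_neq0.
Qed.

(** As [n] is nonzero in [K], X^n - 1 is separable and has [n] distinct roots; among that many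
    [n]-th roots of unity one is primitive. *)
Lemma closed_prim_root_exists n : n%:R != 0 :> K ->
  exists lam : K, n.-primitive_root lam.
Proof.
move=> n0; have n_gt0 : (0 < n)%N by case: n n0 => //; rewrite eqxx.
pose u : {poly K} := 'X^n - 1; have [r Du] := closed_field_poly_normal u.
rewrite (monicP _) ?monicXnsubC // scale1r in Du.
have rn1 : all n.-unity_root r by apply/allP=> z; rewrite -root_prod_XsubC -Du.
have sz_r : (n < (size r).+1)%N by rewrite -(size_prod_XsubC r id) -Du size_XnsubC.
have [|z] := hasP (has_prim_root n_gt0 rn1 _ sz_r); last by exists z.
by rewrite -separable_prod_XsubC -Du separable_Xn_sub_1.
Qed.

(** Existence takes q-th roots of the coefficients, which additivity of Frobenius reassembles;
    uniqueness is injectivity of Frobenius on polynomials. *)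
Lemma frobenius_root_exists p f : p \in [pchar K] -> f \is monic ->
  (1 < size f)%N -> exists f1, unique (is_frobenius_root p f) f1.
Proof.
move=> pK f_monic f_gt1; have pr_p := pcharf_prime pK.
set q := (p ^ poly_gcd_exp p f)%N.
have q_gt0 : (0 < q)%N by rewrite expn_gt0 prime_gt0.
have pKX : p \in [pchar {poly K}] by rewrite pchar_poly.
have root_ex (c : K) : exists x, x ^+ q == c.
  (* With [c] as the only coefficient on the right-hand side, the monic equation becomes x^q = c. *)
  have [x xq] := solve_monicpoly (fun i => if i == 0%N then c else 0) q_gt0.
  exists x; rewrite xq (bigD1 (Ordinal q_gt0)) //= mulr1 big1 ?addr0 // => i i0.
  by rewrite ifN ?mul0r.
pose r c := xchoose (root_ex c).
have rE c : r c ^+ q = c by apply/eqP/(xchooseP (root_ex c)).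
pose f1 := \poly_(j < size f) r f`_(j * q).
have f1E : f1 ^+ q = f.
  rewrite /f1 poly_def expr_sum_pexpn //.
  have -> : \sum_(j < size f) (r f`_(j * q) *: 'X^j) ^+ q =
      (\poly_(j < size f) f`_(j * q)) \Po 'X^q.
    rewrite poly_def raddf_sum /=; apply: eq_bigr => j _.
    by rewrite exprZn rE comp_polyZ comp_Xn_poly exprAC.
  apply/polyP=> k; rewrite coef_comp_poly_Xn // coef_poly.
  case: ifP => [/dvdnP[j ->]|/negbT qk].
    rewrite mulnK //; case: ltnP => // le_j.
    by rewrite nth_default // (leq_trans le_j) // leq_pmulr.
  (* Exponents not divisible by [q] do not occur in [f], because [q] divides gcd(f). *)
  apply/esym/eqP; apply: contraNT qk => /poly_gcd_dvd; apply: dvdn_trans.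
  by rewrite (poly_gcdE p f_gt1) dvdn_mulr.
have f1_monic : f1 \is monic.
  rewrite monicE; apply/eqP/(expr_pexpn_inj pr_p (s := poly_gcd_exp p f) pK).
  by rewrite /= expr1n -/q -lead_coef_exp f1E (monicP f_monic).
exists f1; split; last first.
  move=> f2 [_ _ f2E]; apply: (expr_pexpn_inj pr_p (s := poly_gcd_exp p f) pKX).
  by rewrite /= -f2E -/q f1E.
split=> //; rewrite ltnNge; apply/negP=> /size1_polyC f1C.
by move: f_gt1; rewrite -f1E f1C -rmorphXn /= size_polyC; case: (_ != 0).
Qed.

End ClosedField.

(** * From cyclic eigengroups to presentations and back *)

Section Presentations.

Variables (K : closedFieldType) (p : nat) (pK : p \in [pchar K]).
Variables (f : {poly K}) (f_monic : f \is monic).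
Variable f_roots : exists a b : K, [/\ a != b, root f a & root f b].

Let pr_p : prime p := pcharf_prime pK.

Lemma dilation_eigen_presentation n nu lam c : n.-primitive_root lam ->
  dilation nu lam f = c *: f -> exists i g, presentation f n nu i g.
Proof using f_monic f_roots.
move=> lam_n /dilation_eigenE df.
have h_monic : f \Po ('X + nu%:P) \is monic by rewrite monic_comp_XaddC.
have [i [g [hE g_monic g0]]] := comp_scaleX_eigenP h_monic lam_n df.
exists i, g; apply/presentation_XaddC; split=> //.
rewrite ltnNge; apply/negP => /size1_polyC gC.
case: f_roots => a [b [/eqP neq_ab fa fb]].
(* A constant [g] would make [f] a power of X - nu, against the two distinct roots. *)
have g1 : g = 1.
  by move: g_monic; rewrite gC monicE lead_coefC => /eqP ->.
have root_nu x : root f x -> x = nu.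
  rewrite -[f](comp_polyXaddC_K f nu) hE g1 comp_polyC mulr1 comp_Xn_poly.
  by rewrite /root horner_exp hornerXsubC expf_eq0 subr_eq0 => /andP[_ /eqP].
by apply: neq_ab; rewrite (root_nu _ fa) (root_nu _ fb).
Qed.

Lemma primitive_root_pcharN n (lam : K) : n.-primitive_root lam -> ~~ (p %| n)%N.
Proof using pK.
by move=> lam_n; rewrite (dvdn_pcharf pK) (prim_root_natf_neq0 lam_n).
Qed.

(** With m = gcd_p(g), the product nm is prime to [p], so a primitive root [mu] of that order
    exists. Its dilation lies in the eigengroup, which forces mu^n = 1 and hence m = 1. *)
Lemma cyclic_eigengroup_presentation n nu lam :
  cyclic_eigengroup f n nu lam -> exists i g,
    [/\ presentation f n nu i g, (2 <= n)%N, ~~ (p %| n)%N & poly_gcd_p p g = 1%N].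
Proof using All.
case/(cyclic_eigengroupP n nu lam f_monic) => lam_n rigid n_gt1 eigP.
have n_gt0 := ltnW n_gt1.
have /eigP[_ [c _ df]] : exists2 a, a ^+ n = 1 & dilation nu lam =1 dilation nu a.
  by exists lam => //; apply: prim_expr_order.
have [i [g f_pres]] := dilation_eigen_presentation lam_n df.
have pn := primitive_root_pcharN lam_n.
exists i, g; split=> //; set m := poly_gcd_p p g.
have [_ _ g_gt1 _] := f_pres.
have m_gt0 : (0 < m)%N by rewrite part_gt0.
have pm : ~~ (p %| m)%N.
  by rewrite -p'natE // part_pnat.
have [mu mu_nm] : exists mu : K, (n * m).-primitive_root mu.
  by apply: closed_prim_root_exists; rewrite -(dvdn_pcharf pK) Euclid_dvdM // negb_or pn.
have mu0 : mu != 0 by rewrite (prim_root_eq0 mu_nm) -lt0n muln_gt0 n_gt0.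
have dmu : dilation nu mu f = mu ^+ i *: f.
  apply/(presentation_dilation _ f_pres) => //; split=> // j /poly_gcd_dvd.
  rewrite (poly_gcdE p g_gt1) -/m => /(dvdn_trans (dvdn_mull _ (dvdnn m))) mj.
  by apply/eqP; rewrite -(prim_order_dvd mu_nm) dvdn_pmul2l.
have /eigP[a an /(_ 'X)] := eigengroup_sigma (monic_neq0 f_monic) mu0 dmu.
(* Comparing the linear coefficients of the images of ['X] identifies [mu] with [a]. *)
rewrite /dilation /sigma !comp_polyX => /polyP/(_ 1%N).
rewrite !coefD !coefZ !coefX !coefC /= !mulr1 !addr0 => mu_a.
have /eqP : mu ^+ n = 1 by rewrite mu_a.
rewrite -(prim_order_dvd mu_nm) -{2}[n]muln1 dvdn_pmul2l // dvdn1.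
by move/eqP.
Qed.

Lemma presentation_cyclic_eigengroup n nu lam i g : n.-primitive_root lam ->
  shift_rigid f -> (2 <= n)%N -> presentation f n nu i g ->
  poly_gcd_p p g = 1%N -> cyclic_eigengroup f n nu lam.
Proof using All.
move=> lam_n rigid n_gt1 f_pres g1; apply/cyclic_eigengroupP => //.
have n_gt0 := ltnW n_gt1; have f0 := monic_neq0 f_monic.
have lam0 : lam != 0 by rewrite (prim_root_eq0 lam_n) -lt0n.
have lam1 := prim_root_neq1 lam_n n_gt1.
have dlam := presentation_dilation_root f_pres n_gt0 (prim_expr_order lam_n).
split=> // s; split=> [s_eig | [a an sE]].
  have [a a0 sE] := eigengroup_dilation f_monic rigid lam0 lam1 dlam s_eig.
  exists a => //; have [_ [c _]] := s_eig.
  rewrite sE => /(presentation_dilation _ f_pres n_gt0 a0)[_ anj].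
  have [_ _ g_gt1 _] := f_pres.
  have /(expr_poly_gcd g_gt1) : forall j, g`_j != 0 -> (a ^+ n) ^+ j = 1.
    by move=> j /anj; rewrite exprM.
  (* As gcd_p(g) = 1, the exponent gcd(g) is a power of [p], which injectivity of Frobenius
     removes. *)
  rewrite (poly_gcdE p g_gt1) g1 muln1 => an1.
  by apply: (expr_pexpn_inj pr_p (s := poly_gcd_exp p g) pK); rewrite /= an1 expr1n.
apply: (@eigengroup_eq _ f (dilation nu a)) => [h|]; first by rewrite sE.
apply: (@eigengroup_sigma _ f _ _ (a ^+ i)) => //; last first.
  exact: presentation_dilation_root f_pres n_gt0 an.
exact: unity_root_neq0 an.
Qed.

(** Invariance descends from [f] to [f1] by injectivity of Frobenius. Differentiating at the fixed
    point [nu] gives lam f1'(nu) = f1'(nu), while [lam] is not 1. *)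
Lemma frobenius_root_deriv f1 n nu lam : is_frobenius_root p f f1 ->
  n.-primitive_root lam -> (2 <= n)%N -> dilation nu lam f = f ->
  root f1^`() nu.
Proof using pK.
move=> [_ _ f1E] lam_n n_gt1 df.
have pKX : p \in [pchar {poly K}] by rewrite pchar_poly.
have df1 : dilation nu lam f1 = f1.
  apply: (expr_pexpn_inj pr_p (s := poly_gcd_exp p f) pKX) => /=.
  by rewrite -f1E -[RHS]df [in RHS]f1E /dilation /sigma rmorphXn.
have /(congr1 (fun h => h.[nu])) := congr1 (@deriv K) df1.
rewrite /dilation /sigma deriv_comp derivD derivZ derivX derivC addr0.
rewrite hornerM horner_comp !hornerE.
have -> : lam * nu + (1 - lam) * nu = nu by ring.
rewrite /= mulr1 -[X in _ = X]mulr1 => /eqP.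
rewrite -subr_eq0 -mulrBr mulf_eq0 => /orP[] //.
by rewrite subr_eq0 (negPf (prim_root_neq1 lam_n n_gt1)).
Qed.

End Presentations.

(** * The equivalence and its consequences *)

Theorem theorem4p20 (K : closedFieldType) (p : nat) (pK : p \in [pchar K])
    (f : {poly K}) (f_monic : f \is monic)
    (f_roots : exists a b : K, [/\ a != b, root f a & root f b]) :
  exists f1 : {poly K},
    unique (is_frobenius_root p f) f1 /\
    (forall (n : nat) (nu : K),
       (exists lam : K, cyclic_eigengroup f n nu lam) <->
       cyclic_presentation p f n nu) /\
    (forall (n : nat) (nu lam : K), cyclic_eigengroup f n nu lam ->
       exists (i : nat) (g : {poly K}),
         presentation f n nu i g /\
         (forall (nu' : K) (i' : nat) (g' : {poly K}),
            presentation f n nu' i' g' -> [/\ nu' = nu, i' = i & g' = g]) /\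
         ((root f nu /\ (1 <= i)%N) \/
          [/\ ~~ root f nu, i = 0%N & root f1^`() nu]) /\
         (root f nu ->
            n = poly_gcd_p p ((f \Po ('X + nu%:P)) %/ 'X^i)) /\
         (~~ root f nu -> n = poly_gcd_p p (f \Po ('X + nu%:P))) /\
         sigma lam ((1 - lam) * nu) f = lam ^+ i *: f /\
         (group_invariant (eigengroup f) f <-> (n %| i)%N)).
Proof.
have pr_p := pcharf_prime pK; have f0 := monic_neq0 f_monic.
have ex_root : exists a, root f a by case: f_roots => a [_ [_ fa _]]; exists a.
have rigidP := shift_rigidP pr_p f_monic ex_root.
have f_gt1 : (1 < size f)%N.
  by case: ex_root => a /root_size_gt1; apply.
have [f1 [f1_root f1_uniq]] := frobenius_root_exists pK f_monic f_gt1.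
exists f1; split; first by split.
split=> [n nu | n nu lam eig].
  split=> [[lam eig] | [i [g [f_pres [n_gt1 pn g1] f_roots_b]]]].
    have [i [g [f_pres n_gt1 pn g1]]] :=
      cyclic_eigengroup_presentation pK f_monic f_roots eig.
    by exists i, g; split=> //; apply/rigidP; case/cyclic_eigengroupP: eig.
  have [lam lam_n] : exists lam : K, n.-primitive_root lam.
    by apply: closed_prim_root_exists; rewrite -(dvdn_pcharf pK).
  exists lam; apply: presentation_cyclic_eigengroup f_pres g1 => //.
  exact/rigidP.
have [i [g [f_pres n_gt1 pn g1]]] :=
  cyclic_eigengroup_presentation pK f_monic f_roots eig.
have [lam_n rigid _ eigP] := (cyclic_eigengroupP n nu lam f_monic).1 eig.
have n_gt0 := ltnW n_gt1.
have dlam := presentation_dilation_root f_pres n_gt0 (prim_expr_order lam_n).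
have lam0 : lam != 0 by rewrite (prim_root_eq0 lam_n) -lt0n.
have lam1 := prim_root_neq1 lam_n n_gt1.
have rootE := presentation_root f_pres n_gt0.
have [hE _ g_gt1 _] := (presentation_XaddC f n nu i g).1 f_pres.
(* Both formulas for [n] reduce to this one: recentred at [nu] and stripped of X^i, [f] becomes
   g(X^n). *)
have gcd_n := poly_gcd_p_comp_polyXn pr_p pn n_gt0 g_gt1 g1.
exists i, g; split=> //; split; [|split; [|split; [|split; [|split=> //]]]].
- move=> nu' i' g' f_pres'.
  (* The second presentation puts the dilation by [lam] about [nu'] into the eigengroup, so its
     constant term (1 - lam) nu' must equal (1 - lam) nu. *)
  have nu_eq : nu' = nu.
    have dlam' := presentation_dilation_root f_pres' n_gt0 (prim_expr_order lam_n).
    have := eigengroup_fixpoint f0 rigid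
      (eigengroup_sigma f0 lam0 dlam') lam0 lam0 lam1.
    move/(_ nu (ex_intro _ _ dlam))/mulfI; apply.
    by rewrite subr_eq0 eq_sym.
  rewrite nu_eq in f_pres' *.
  by have [-> ->] := presentation_inj n_gt0 f_pres f_pres'.
- case: (posnP i) => [i0|i_gt0]; last by left; rewrite rootE.
  right; split=> //; first by rewrite rootE i0.
  apply: (frobenius_root_deriv pK f1_root lam_n n_gt1).
  (* For i = 0 the eigenvalue lam^i is 1, so [f] itself is invariant. *)
  by rewrite dlam i0 scale1r.
- by rewrite hE mulrC mulpK // -size_poly_eq0 size_polyXn.
- by rewrite rootE -eqn0Ngt => /eqP i0; rewrite hE i0 mul1r.
split=> [inv | ni s /eigP[a an ->]].
  have /inv : eigengroup f (dilation nu lam) by apply: eigengroup_sigma dlam.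
  rewrite dlam -[RHS]scale1r => /eqP.
  by rewrite -subr_eq0 -scalerBl scaler_eq0 (negPf f0) orbF subr_eq0
    -(prim_order_dvd lam_n).
rewrite (presentation_dilation_root f_pres n_gt0 an).
by case/dvdnP: ni => k ->; rewrite mulnC exprM an expr1n scale1r.
Qed.
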